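(* Let $(\Omega,\mathcal{F})$ be a measurable space, let $X$ be a finite dimensional Banach space with $B_2$ separable, and let $T:\Omega\times B_2\to E(X,B_1)$ be a random operator which satisfies condition $\mathcal{M}$. Suppose that, for each $\omega\in\Omega$, $T(\omega,\cdot)$ is lower semicontinuous, 1-set-contractive, with nonempty values, and that the inverse $(T(\omega,\cdot))^{-1}$ is closed valued, i.e. $\{x\in B_2: y\in T(\omega,x)\}$ is closed for every $y\in X$. Then there exist a measurable mapping $\xi:\Omega\to B_1$ and a mapping $\eta:\Omega\to X$ such that for each $\omega\in\Omega$ $$\eta(\omega)\in T(\omega,\xi(\omega))$$ and $$\|\eta(\omega)-\xi(\omega)\|=d(\eta(\omega),B_1)=d\big(\eta(\omega),\overline{I_{B_1}(\xi(\omega))}\big).$$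
   Context: For $R>0$, $B_R=\{x\in X:\|x\|\le R\}$. For $x\in X$, $B(x,r)=\{y\in X:\|y-x\|<r\}$, and $E(X,B_1)=\{B(x,r)\subset X: x\in B_1,\ r\ge 0\}$; so each value $T(\omega,x)$ is a subset of $X$ of the form $B(c,r)$ with $c\in B_1$. For $B_0\subseteq X$, $d(y,B_0)=\inf_{x\in B_0}\|y-x\|$. The inward set of $C\subseteq X$ at $x$ is $I_C(x)=\{x+r(y-x): y\in C,\ r\ge 0\}$; the bar denotes closure. $2^{X}$ is the set of nonempty subsets of $X$; for $F:B_2\to 2^{X}$ and $A\subseteq B_2$, $F(A)=\bigcup_{x\in A}F(x)$. Random operator: for each $x\in B_2$, $T(\cdot,x)$ is (lower) measurable, i.e. $\{\omega\in\Omega: T(\omega,x)\cap V\neq\emptyset\}\in\mathcal{F}$ for every open $V\subseteq X$. Lower semicontinuous: $F:B_2\to 2^{X}$ is lower semicontinuous if for each $x\in B_2$ and each open $V\subseteq X$ with $F(x)\cap V\neq\emptyset$ there is an open neighborhood $U$ of $x$ in $B_2$ with $F(y)\cap V\neq\emptyset$ for each $y\in U$. 1-set-contractive: $\gamma$ is the Kuratowski measure of noncompactness: for bounded $A\subseteq X$, $\gamma(A)=\inf\{e>0: A$ is covered by a finite number of sets of diameter $\le e\}$, and $\gamma(A)=\infty$ if $A$ is unbounded. $F:B_2\to 2^{X}$ is 1-set-contractive if $\gamma(F(A))\le\gamma(A)$ for each $A\subseteq B_2$ with $\gamma(A)>0$. Random fixed point of $T$: a measurable mapping $\xi:\Omega\to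 B_2$ with $\xi(\omega)\in T(\omega,\xi(\omega))$ for every $\omega\in\Omega$. Condition $\mathcal{M}$ for $T$ (with domain set $C=B_2$): whenever $\eta_n,\xi_n:\Omega\to C$ ($n\in\mathbb{N}$) are measurable mappings with $\eta_n(\omega)\in T(\omega,\xi_n(\omega))$ for each $n$ and each $\omega\in\Omega$, and $\xi_n(\omega)-\eta_n(\omega)\to 0$ as $n\to\infty$ for each $\omega\in\Omega$, then there exists a random fixed point $\xi$ of $T$. *)

(* Defs.v *)
From HB Require Import structures.
From mathcomp Require Export all_boot all_order all_algebra.
From mathcomp Require Export all_classical all_reals all_analysis.

Set Implicit Arguments.
Unset Strict Implicit.
Unset Printing Implicit Defensive.

Export Order.TTheory GRing.Theory Num.Theory.
Export numFieldNormedType.Exports.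

Local Open Scope classical_set_scope.
Local Open Scope ring_scope.

(* A set-valued map F : D -> 2^X with D a subset of X is encoded as a total
   function F : X -> set X together with D; the definitions below only look at
   the values of F on D, and nonemptiness of these values is assumed
   separately. *)

Definition finite_dimensional (R : realType) (X : lmodType R) : Prop :=
  exists n : nat, inhabited (Vector.axiom n X).

Definition norm_ball0 (R : realType) (X : normedModType R) (r : R) : set X :=
  [set x | `|x| <= r].

Definition separable_set (X : topologicalType) (A : set X) : Prop :=
  exists S : set X, [/\ countable S, S `<=` A & A `<=` closure S].

(* [ball c r] is the open ball of the norm; it is empty for r = 0. *)
Definition balls_centered_in (R : realType) (X : normedModType R)
    (C : set X) : set (set X) :=
  [set A | exists c r, [/\ C c, 0 <= r & A = ball c r]].

Definition dist_to_set (R : realType) (X : normedModType R)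
    (y : X) (B : set X) : R :=
  inf [set `|y - x| | x in B].

Definition inward_set (R : realType) (X : normedModType R)
    (C : set X) (x : X) : set X :=
  [set z | exists y r, [/\ C y, 0 <= r & z = x + r *: (y - x)]].

Definition lower_measurable (d : measure_display) (Omega : measurableType d)
    (X : topologicalType) (G : Omega -> set X) : Prop :=
  forall V : set X, open V -> measurable [set w | G w `&` V !=set0].

Definition random_operator (d : measure_display) (Omega : measurableType d)
    (X : topologicalType) (D : set X) (T : Omega -> X -> set X) : Prop :=
  forall x, D x -> lower_measurable (T ^~ x).

Definition lower_semicontinuous_on (X : topologicalType) (D : set X)
    (F : X -> set X) : Prop :=
  forall x V, D x -> open V -> F x `&` V !=set0 ->
    exists U, [/\ open U, U x &
      forall y, (U `&` D) y -> F y `&` V !=set0].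

(* The diameter of the empty set is -oo here instead of 0, which makes no
   difference when compared with e > 0. *)
Definition diameter (R : realType) (X : normedModType R) (A : set X) : \bar R :=
  ereal_sup [set `|x - y|%:E | x in A & y in A].

Definition kuratowski (R : realType) (X : normedModType R) (A : set X)
    : \bar R :=
  if `[< bounded_set A >] then
    ereal_inf [set e%:E | e in [set e : R | 0 < e /\
      exists (n : nat) (S : 'I_n -> set X),
        A `<=` \bigcup_i S i /\ forall i, (diameter (S i) <= e%:E)%E]]
  else +oo%E.

Definition one_set_contractive (R : realType) (X : normedModType R)
    (D : set X) (F : X -> set X) : Prop :=
  forall A, A `<=` D -> (0 < kuratowski A)%E ->
    (kuratowski (\bigcup_(x in A) F x) <= kuratowski A)%E.

Definition inverse_on (X : Type) (D : set X) (F : X -> set X) (y : X) : set X :=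
  [set x | D x /\ F x y].

(* Measurability for the Borel sigma-algebra of X; for maps with values in D it
   is measurability for the Borel sigma-algebra of the subspace D. *)
Definition measurable_map (d : measure_display) (Omega : measurableType d)
    (X : ptopologicalType) (D : set X) (xi : Omega -> X) : Prop :=
  (forall w, D (xi w)) /\
  measurable_fun setT (xi : Omega -> g_sigma_algebraType (@open X)).

Definition random_fixed_point (d : measure_display) (Omega : measurableType d)
    (X : ptopologicalType) (D : set X) (T : Omega -> X -> set X)
    (xi : Omega -> X) : Prop :=
  measurable_map D xi /\ forall w, T w (xi w) (xi w).

Definition condition_M (d : measure_display) (Omega : measurableType d)
    (R : realType) (X : normedModType R) (D : set X)
    (T : Omega -> X -> set X) : Prop :=
  forall eta xi : nat -> Omega -> X,
    (forall n, measurable_map D (eta n)) ->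
    (forall n, measurable_map D (xi n)) ->
    (forall n w, T w (xi n w) (eta n w)) ->
    (forall w, (fun n => xi n w - eta n w) @ \oo --> (0 : X)) ->
    exists xi0, random_fixed_point D T xi0.

(* Main.v *)
(** In finite dimension a point [s] belongs to an open ball [B] as soon as [B]
    comes close enough to finitely many points surrounding [s]. Hence a lower
    semicontinuous map with open ball values has relatively open fibres
    [{x | y \in F x}]. Here the fibres are also closed and [B_2] is connected,
    so [T w] is constant on [B_2]. Its value meets the open unit ball, because
    its center lies in [B_1]; the same finite criterion shows that
    [{w | s \in T w 0}] is measurable for each [s], so the first point of a
    countable dense set that lies in [B_1] and in [T w 0] is a measurable random
    fixed point [xi w] in [B_1], and [eta := xi] makes both distances vanish. *)

From HB Require Import structures.
Require Import Defs.
From mathcomp Require Import finmap lra.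

Set Implicit Arguments.
Unset Strict Implicit.
Unset Printing Implicit Defensive.

Local Open Scope classical_set_scope.
Local Open Scope ring_scope.

(** * Finite nets of the unit sphere *)

(** In coordinates, the norm of [X] is bounded below by a positive multiple of the norm of row
    vectors. Hence the sphere is the continuous image of a closed bounded set of row vectors. *)
Lemma unit_sphere_compact (R : realType) (X : normedModType R) :
  finite_dimensional X -> compact [set x : X | `|x| = 1].
Proof.
move=> [n [[f lin_f [g fK gK]]]].
pose fL := GRing.isLinear.Build R X 'rV[R]_n _ f lin_f.
pose F : {linear X -> 'rV[R]_n} := HB.pack f fL.
have gD u v : g (u + v) = g u + g v.
  by rewrite -{1}(gK u) -{1}(gK v) -[f (g u) + _]/(F (g u) + F (g v)) -raddfD fK.
have gZ a u : g (a *: u) = a *: g u.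
  by rewrite -{1}(gK u) -[a *: f (g u)]/(a *: F (g u)) -linearZ fK.
have g0 : g 0 = 0 by rewrite -[0 in LHS](scale0r 0) gZ scale0r.
have gE v : g v = \sum_(i < n) v ord0 i *: g (delta_mx ord0 i).
  rewrite [in LHS](row_sum_delta v).
  elim/big_ind2: _ => [|x1 x2 y1 y2 <- <-|i _]; [exact: g0|exact: gD|exact: gZ].
have g_cont : continuous g.
  rewrite (_ : g = fun v => \sum_(i < n) v ord0 i *: g (delta_mx ord0 i)).
    apply: continuous_big => [|i _ v]; first exact: add_continuous.
    by apply: (@cvgZr_tmp _ _ _ (nbhs v)); exact: coord_continuous.
  by apply/funext => ?; exact: gE.
have ng_cont : continuous (fun v => `|g v|).
  by move=> v; apply: continuous_comp; [exact: g_cont|exact: norm_continuous].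
have [m m_gt0 m_le] : exists2 m : R, 0 < m & forall v, m * `|v| <= `|g v|.
  pose S := [set v : 'rV[R]_n | `|v| = 1].
  (* If [S] is empty, every row vector is 0 and [m = 1] works; otherwise [m] is the minimum of
     [|g v|] on [S], positive since [g] is injective. *)
  have [S0|/set0P/negP/negPn/eqP S0] := pselect (S !=set0); last first.
    exists 1 => // v; have [->|v0] := eqVneq v 0; first by rewrite normr0 mulr0.
    suff : S (`|v|^-1 *: v) by rewrite S0.
    by rewrite /S/= normrZ normfV normr_id mulVf ?normr_eq0.
  have S_compact : compact S.
    apply: bounded_closed_compact.
      by exists 1; split => // x x1 v /= ->; exact: ltW.
    rewrite (_ : S = (fun v => `|v|) @^-1` [set 1 : R])//.
    by apply: preimage_closed => [v _|]; [exact: norm_continuous|exact: closed_eq].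
  have [c /set_mem Sc cmin] := compact_EVT_min S0 S_compact
    (continuous_subspaceT ng_cont).
  exists `|g c|.
    rewrite normr_gt0; apply/eqP => gc0; move: Sc.
    rewrite /S/= -(gK c) gc0 -[f 0]/(F 0) raddf0 normr0 => /esym/eqP.
    by rewrite oner_eq0.
  move=> v; have [->|v0] := eqVneq v 0; first by rewrite normr0 mulr0.
  have /mem_set/cmin : S (`|v|^-1 *: v).
    by rewrite /S/= normrZ normfV normr_id mulVf ?normr_eq0.
  by rewrite gZ normrZ normfV normr_id ler_pdivlMl ?normr_gt0// mulrC.
rewrite (_ : [set _ | _] = g @` [set v | `|g v| = 1]); last first.
  by apply/seteqP; split => [x x1|_ [v v1 <-]//]; exists (f x); rewrite /= fK.
apply: continuous_compact; first exact: continuous_subspaceT.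
apply: bounded_closed_compact.
  exists m^-1; split; first by rewrite gtr0_real ?invr_gt0.
  move=> x x1 v /= gv1; apply: ltW; apply: le_lt_trans x1.
  by rewrite -[leRHS]mulr1 ler_pdivlMl// -gv1.
rewrite (_ : [set v | _] = (fun v => `|g v|) @^-1` [set 1 : R])//.
by apply: preimage_closed => [v _|]; [exact: ng_cont|exact: closed_eq].
Qed.

Lemma unit_sphere_net (R : realType) (X : normedModType R) (e : R) :
  finite_dimensional X -> 0 < e ->
  exists U : {fset X}, forall v : X, `|v| = 1 ->
    exists2 u, u \in U & `|u - v| < e.
Proof.
move=> /unit_sphere_compact; rewrite compact_cover => sphereX e0.
have [||U US cov] := sphereX X setT (fun u => ball u e).
- by move=> u _; exact: ball_open.
- by move=> v _; exists v => //; exact: ballxx.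
by exists U => v /cov[u uU]; rewrite -ball_normE; exists u.
Qed.

(* If s lies outside the ball, the point [s + e *: v] with v the unit vector
   pointing from c to s is at distance at least [r + e] from c. *)
Lemma ball_mem_of_net (R : realType) (X : normedModType R) (U : {fset X})
    (c s : X) (r e : R) :
  (forall v : X, `|v| = 1 -> exists2 u, u \in U & `|u - v| < 2^-1) ->
  0 < r -> 0 < e ->
  (forall u, u \in U -> ball c r `&` ball (s + e *: u) (e / 2) !=set0) ->
  ball c r s.
Proof.
move=> netU r0 e0 meet; rewrite -ball_normE /=; rewrite ltNge; apply/negP => le_r.
have cs0 : 0 < `|s - c| by rewrite distrC; exact: lt_le_trans le_r.
pose v := `|s - c|^-1 *: (s - c).
have v1 : `|v| = 1 by rewrite normrZ normfV normr_id mulVf ?gt_eqF.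
have [u uU uv] := netU v v1.
have [z []] := meet u uU.
rewrite -ball_normE /= => zc zs.
have : `|s + e *: v - c| = `|s - c| + e.
  have -> : s + e *: v - c = (1 + e / `|s - c|) *: (s - c).
    by rewrite scalerDl scale1r -scalerA addrAC.
  rewrite normrZ gtr0_norm ?addr_gt0 ?divr_gt0//.
  by rewrite mulrDl mul1r mulfVK ?gt_eqF.
(* The net error and the radius of the small ball contribute less than [e / 2] each, so the left
   side is below [r + e], a contradiction. *)
have : `|s + e *: v - c| <= e * `|u - v| + `|s + e *: u - z| + `|c - z|.
  have -> : e * `|u - v| = `|e *: (v - u)| by rewrite normrZ gtr0_norm// distrC.
  rewrite (distrC c) -[s + e *: v - c](_ :
      e *: (v - u) + (s + e *: u - z) + (z - c) = _).
    by rewrite (le_trans (ler_normD _ _))// lerD2r ler_normD.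
  rewrite scalerBr 2!addrA subrK; congr (_ - c).
  by rewrite [s + e *: u]addrC addrA subrK addrC.
rewrite distrC in le_r.
have : e * `|u - v| < e * 2^-1 by rewrite ltr_pM2l.
lra.
Qed.

(** A converse to the finite criterion: for small [e] the centers [s + e *: u] themselves lie in
    [A], simultaneously for the finitely many [u]. *)
Lemma open_meets_net (R : realType) (X : normedModType R) (U : {fset X})
    (A : set X) (s : X) :
  open A -> A s ->
  \forall e \near 0^'+, forall u, u \in U ->
    A `&` ball (s + e *: u) (e / 2) !=set0.
Proof.
move=> oA As.
have near_u u : u \in U -> \forall e \near 0^'+, A (s + e *: u).
  move=> _; apply: cvg_within; rewrite /=.
  have : (s + e *: u) @[e --> (0:R)] --> s + 0 *: u.
    by apply: cvgD; [exact: cvg_cst|apply: cvgZr_tmp; exact: cvg_id].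
  by apply; rewrite scale0r addr0; apply: open_nbhs_nbhs.
apply: filterS2 (nbhs_right_gt 0) (filter_bigI _ near_u) => e e0 AU u uU.
exists (s + e *: u); split; first exact: AU.
by apply: ballxx; rewrite divr_gt0.
Qed.

(** * Constancy on connected domains *)

Lemma lsc_ball_connected_constant (R : realType) (X : normedModType R)
    (D : set X) (F : X -> set X) (y : X) :
  finite_dimensional X -> connected D ->
  (forall x, D x -> exists c r, 0 <= r /\ F x = ball c r) ->
  lower_semicontinuous_on D F ->
  (forall x, D x -> F x !=set0) ->
  closed (inverse_on D F y) ->
  forall x x', D x -> F x y -> D x' -> F x' y.
Proof.
move=> finX connD ballF lscF nonemptyF closedF x x' Dx Fxy Dx'.
suff : inverse_on D F y = D by move=> /seteqP[_ /(_ _ Dx')[]].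
apply: connD; first by exists x.
  (* Points outside [D] belong to [P], so its interior is an open set of [X] whose trace on [D] can
     be the whole fibre. *)
  pose P := [set z | D z -> F z y].
  exists P^°; first exact: open_interior.
  apply/seteqP; split => z; last by move=> [Dz /interior_subset/(_ Dz)].
  move=> [Dz Fzy]; split => //.
  have half_gt0 : 0 < 2^-1 :> R by rewrite invr_gt0.
  have [U netU] := unit_sphere_net finX half_gt0.
  have oFz : open (F z) by have [c [r [_ ->]]] := ballF z Dz; exact: ball_open.
  (* The scale [e] is fixed at [z]; lower semicontinuity then carries the finitely many meetings
     over to all nearby points of [D]. *)
  have [e [e0 meetz]] : exists e : R, 0 < e /\ forall u, u \in U ->
      F z `&` ball (y + e *: u) (e / 2) !=set0.
    apply: (@filter_ex _ (0:R)^'+).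
    by apply: filterI; [exact: nbhs_right_gt|exact: open_meets_net].
  have near_u u : u \in U -> \forall t \near z,
      D t -> F t `&` ball (y + e *: u) (e / 2) !=set0.
    move=> /meetz/(lscF z _ Dz (ball_open _ _))[W [oW Wz FW]].
    apply: filterS (open_nbhs_nbhs (conj oW Wz)) => t Wt Dt.
    by apply: FW.
  apply: filterS (filter_bigI _ near_u) => t meett Dt.
  have [c [r [r_ge0 Ft]]] := ballF t Dt.
  rewrite Ft; apply: (ball_mem_of_net netU _ e0).
    have [q] := nonemptyF t Dt.
    by rewrite Ft -ball_normE /=; apply: le_lt_trans.
  by move=> u uU; have := meett u uU Dt; rewrite Ft.
exists (inverse_on D F y) => //.
by rewrite setIidr// => z [].
Qed.

(** The ball is a union of segments issuing from 0, or empty if [r < 0]. *)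
Lemma norm_ball0_connected (R : realType) (X : normedModType R) (r : R) :
  connected (norm_ball0 r : set X).
Proof.
rewrite (_ : norm_ball0 r =
    \bigcup_(x in norm_ball0 r) ((fun t : R => t *: (x : X)) @` `[0, 1])).
  have [r0|r0] := leP 0 r; last first.
    rewrite bigcup0 => [|x /le_lt_trans/(_ r0)]; first exact: connected0.
    by rewrite normr_lt0.
  apply: bigcup_connected.
    by exists 0 => x _; exists 0; rewrite /= ?scale0r// in_itv/= lexx ler01.
  move=> x _; apply: connected_continuous_connected.
    exact: segment_connected.
  apply: continuous_subspaceT => t; apply: cvgZr_tmp; exact: cvg_id.
apply/seteqP; split => [x Bx|y [x /= Bx [t]]].
  by exists x => //; exists 1; rewrite /= ?scale1r// in_itv/= ler01 lexx.
rewrite /= in_itv/= => /andP[t0 t1] <-.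
rewrite /norm_ball0/= normrZ ger0_norm//.
by apply: le_trans Bx; rewrite ler_piMl.
Qed.

(** * Measurability of membership and of the first index *)

(** The singleton of [s] is not a legitimate test set for lower measurability, but the finite
    criterion at the scales [1 / (n + 1)] involves only open balls. *)
Lemma lower_measurable_ball_mem (R : realType) (d : measure_display)
    (Omega : measurableType d) (X : normedModType R) (G : Omega -> set X)
    (s : X) :
  finite_dimensional X ->
  (forall w, exists c r, 0 < r /\ G w = ball c r) ->
  lower_measurable G -> measurable [set w | G w s].
Proof.
move=> finX ballG measG.
have half_gt0 : 0 < 2^-1 :> R by rewrite invr_gt0.
have [U netU] := unit_sphere_net finX half_gt0.
rewrite (_ : [set w | _] = \bigcup_n \bigcap_(u in [set` U])
    [set w | G w `&` ball (s + (n.+1%:R)^-1 *: u) ((n.+1%:R)^-1 / 2) !=set0]).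
  apply: bigcup_measurable => n _; apply: fin_bigcap_measurable => // u _.
  by apply: measG; exact: ball_open.
apply/seteqP; split => w /=; have [c [r [r0 Gw]]] := ballG w.
  move=> Gws.
  have oG : open (G w) by rewrite Gw; exact: ball_open.
  have := open_meets_net U oG Gws.
  move=> /nbhs_ballP[e /= e0 He].
  near \oo => n.
  exists n => // u uU; apply: He => //=.
    rewrite -ball_normE /= sub0r normrN gtr0_norm ?invr_gt0//.
    near: n; exact: (near_infty_natSinv_lt (PosNum e0)).
move=> [n _ meet]; rewrite Gw; apply: (ball_mem_of_net netU r0 (e := n.+1%:R^-1)).
  by rewrite invr_gt0.
by move=> u uU; rewrite -Gw; exact: meet.
Unshelve. all: by end_near. Qed.

Lemma dense_open_meet (X : topologicalType) (A B S : set X) :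
  B `<=` closure S -> open A -> B `&` A !=set0 -> S `&` A !=set0.
Proof.
by move=> BS oA [x [Bx Ax]]; apply: (BS x Bx); exact: open_nbhs_nbhs.
Qed.

(** With [N w] the least index satisfying [P], a preimage splits into the countably many events that
    [P] holds at [n] and at no earlier index. *)
Lemma measurable_fun_first (d : measure_display) (Omega : measurableType d)
    (X : ptopologicalType) (q : nat -> X) (P : nat -> Omega -> bool) :
  (forall n, measurable [set w | P n w]) -> (forall w, exists n, P n w) ->
  exists2 N : Omega -> nat, (forall w, P (N w) w) &
    measurable_fun setT (q \o N : Omega -> g_sigma_algebraType (@open X)).
Proof.
move=> measP exP; exists (fun w => ex_minn (exP w)).
  by move=> w; case: ex_minnP.
move=> _ V _; rewrite setTI.
rewrite (_ : _ @^-1` V = \bigcup_(n in [set n | V (q n)])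
    ([set w | P n w] `&` \bigcap_(k in `I_n) ~` [set w | P k w])).
  apply: bigcup_measurable => n _; apply: measurableI => //.
  by apply: fin_bigcap_measurable => // k _; exact: measurableC.
apply/seteqP; split => w /=; case: ex_minnP => m Pm minm.
  move=> Vm; exists m => //; split => // k /= km Pk.
  by have := minm k Pk; rewrite leqNgt km.
move=> [n /= Vn [Pn ltn]]; suff -> : m = n by [].
apply/eqP; rewrite eqn_leq minm//= leqNgt; apply/negP => /ltn/=; exact.
Qed.

Lemma dist_to_set_mem (R : realType) (X : normedModType R) (y : X) (B : set X) :
  B y -> dist_to_set y B = 0.
Proof.
move=> By; apply/eqP; rewrite eq_le; apply/andP; split.
  apply: ge_inf; first by exists 0 => _ [x _ <-].
  by exists y => //; rewrite subrr normr0.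
by apply: lb_le_inf => [|_ [x _ <-]//]; exists `|y - y|; exists y.
Qed.

Lemma inward_set_center (R : realType) (X : normedModType R) (C : set X)
    (x : X) : C x -> inward_set C x x.
Proof. by move=> Cx; exists x, 0; rewrite scale0r addr0. Qed.

Theorem corollary5 (R : realType) (d : measure_display)
    (Omega : measurableType d) (X : completeNormedModType R)
    (T : Omega -> X -> set X) :
  finite_dimensional X ->
  separable_set (norm_ball0 (2 : R) : set X) ->
  (forall w x, norm_ball0 2 x ->
    balls_centered_in (norm_ball0 1) (T w x)) ->
  random_operator (norm_ball0 2) T ->
  condition_M (norm_ball0 2) T ->
  (forall w, lower_semicontinuous_on (norm_ball0 2) (T w)) ->
  (forall w, one_set_contractive (norm_ball0 2) (T w)) ->
  (forall w x, norm_ball0 2 x -> T w x !=set0) ->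
  (forall w y, closed (inverse_on (norm_ball0 2) (T w) y)) ->
  exists (xi : Omega -> X) (eta : Omega -> X),
    measurable_map (norm_ball0 1) xi /\
    forall w,
      [/\ T w (xi w) (eta w),
          `|eta w - xi w| = dist_to_set (eta w) (norm_ball0 1) &
          dist_to_set (eta w) (norm_ball0 1) =
          dist_to_set (eta w) (closure (inward_set (norm_ball0 1) (xi w)))].
Proof.
move=> finX [S [countS _ S_dense]] ballT randT _ lscT _ nonemptyT closedT.
have B20 : norm_ball0 2 (0 : X) by rewrite /norm_ball0/= normr0.
have B12 : norm_ball0 1 `<=` (norm_ball0 2 : set X).
  by move=> x /le_trans; apply; rewrite ler1n.
have ballT0 w : exists c r, [/\ norm_ball0 1 c, 0 < r & T w 0 = ball c r].
  have [c [r [Bc _ Tw]]] := ballT w 0 B20; exists c, r; split => //.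
  have [z] := nonemptyT w 0 B20.
  by rewrite Tw -ball_normE; exact: le_lt_trans.
have constT w x x' y : norm_ball0 2 x -> T w x y -> norm_ball0 2 x' -> T w x' y.
  apply: lsc_ball_connected_constant => //;
    [exact: norm_ball0_connected| |exact: nonemptyT].
  by move=> z /(ballT w)[c [r [_ r0 Tz]]]; exists c, r.
(* The center [c] may have norm 1; shrinking it to [(1 - e) *: c] enters the open unit ball without
   leaving [ball c r]. *)
have meetT w : ball (0 : X) (1 : R) `&` T w 0 !=set0.
  have [c [r [Bc r0 ->]]] := ballT0 w.
  have : \forall e \near (0 : R)^'+, ball c r ((1 - e) *: c).
    apply: cvg_within.
    have : (1 - e) *: c @[e --> (0:R)] --> (1 - 0) *: c.
      by apply: cvgZr_tmp; apply: cvgB; [exact: cvg_cst|exact: cvg_id].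
    apply; rewrite subr0 scale1r; exact: nbhsx_ballx.
  move=> near_c.
  have [e [/= e0 [e1 ec]]] := @filter_ex _ (0 : R)^'+ _ _
    (filterI (nbhs_right_gt 0) (filterI (nbhs_right_lt ltr01) near_c)).
  exists ((1 - e) *: c); split => //.
  rewrite -ball_normE /= sub0r normrN normrZ gtr0_norm ?subr_gt0//.
  apply: (@le_lt_trans _ _ (1 - e)); last by rewrite ltrBlDr ltrDl.
  by rewrite ler_piMr// subr_ge0 ltW.
have openT w : open (T w 0).
  by have [c [r [_ _ ->]]] := ballT0 w; exact: ball_open.
(* Density of [S] yields points in open sets only, hence the passage through the open unit ball. *)
have S_meets w : exists2 s, S s & norm_ball0 1 s /\ T w 0 s.
  have oA : open (ball 0 1 `&` T w 0) by apply: openI => //; exact: ball_open.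
  have [|s [Ss [s1 Tws]]] := dense_open_meet S_dense oA.
    have [z [z1 Tz]] := meetT w; exists z; split => //; apply: B12.
    by move: z1; rewrite -ball_normE /= sub0r normrN => /ltW.
  exists s => //; split => //.
  by move: s1; rewrite -ball_normE /= sub0r normrN => /ltW.
(* Either [S] is empty, which density at 0 excludes, or a sequence [q] covers [S]. *)
have [S0|[q]] := pfcard_geP countS.
  by have [s []] := S_dense 0 B20 setT filterT; rewrite S0.
pose P n w := `[< norm_ball0 1 (q n) /\ T w 0 (q n) >].
have measP n : measurable [set w | P n w].
  have [Bq|nBq] := pselect (norm_ball0 1 (q n)).
    rewrite (_ : [set w | _] = [set w | T w 0 (q n)]).
      apply: (lower_measurable_ball_mem (G := fun w => T w 0)) => //;
        last exact: randT.
      by move=> w; have [c [r [_ r0 Tw]]] := ballT0 w; exists c, r.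
    by apply/seteqP; split => w /=; [move=> /asboolP[]|move=> ?; apply/asboolP].
  rewrite (_ : [set w | _] = set0)//.
  by apply/seteqP; split => w //= /asboolP[].
have existsP w : exists n, P n w.
  have [s Ss Bs] := S_meets w.
  have [n _ qn] := @surj _ _ _ _ q s Ss.
  by exists n; apply/asboolP; rewrite qn.
have [N PN measN] := measurable_fun_first q measP existsP.
exists (q \o N), (q \o N); split.
  by split => // w; have /asboolP[] := PN w.
move=> w /=; have /asboolP[Bq Tq] := PN w.
(* [PN] gives membership in [T w 0]; constancy moves it to the value at the selected point. *)
split; first by apply: constT Tq _ => //; exact: B12.
  by rewrite subrr normr0 dist_to_set_mem.
rewrite !dist_to_set_mem//.
by apply: subset_closure; exact: inward_set_center.
Qed.
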